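(* For every integer $k \geq 8$ that is divisible by four, \[ f\left(n,k,\binom{k}{2} - k/2 + 1\right) = \Omega\left(n^{2 - 8/k}\right). \]
   Context: For positive integers $n,k,\ell$, $f(n,k,\ell)$ denotes the minimum number of colors $|C|$ in a coloring $\chi:E\to C$ of the edges of the complete graph $K_n=(V,E)$ such that every set of $k$ vertices of $V$ spans (in the induced complete subgraph $K_k$) edges of at least $\ell$ distinct colors. The parameter $k$ is fixed and the asymptotic notation refers to $n\to\infty$ (implied constants may depend on $k$). *)

(* Defs.v *)
From mathcomp Require Import all_boot.
From Stdlib Require Import Reals.
Set Implicit Arguments. Unset Strict Implicit. Unset Printing Implicit Defensive.

(* Vertices of K_n are 'I_n; an edge is an unordered pair {i,j}, i <> j,
   represented by the ordered pair (i,j) with i < j.  An edge colouring is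
   a finite function on pairs; only its values at (i,j) with i < j matter. *)

Definition coloring (n m : nat) := {ffun 'I_n * 'I_n -> 'I_m}.

Definition spanned_colors n m (chi : coloring n m) (S : {set 'I_n}) : {set 'I_m} :=
  [set chi p | p : 'I_n * 'I_n & [&& p.1 \in S, p.2 \in S & (p.1 < p.2)%N]].

Definition used_colors n m (chi : coloring n m) : {set 'I_m} :=
  [set chi p | p : 'I_n * 'I_n & (p.1 < p.2)%N].

Definition good_coloring n m (k l : nat) (chi : coloring n m) : bool :=
  [forall S : {set 'I_n}, (#|S| == k) ==> (l <= #|spanned_colors chi S|)%N].

(* f(n,k,l): minimum number of colours.  Any colouring with colour set C can
   be relabelled to use only its used colours, of which there are at most
   'C(n,2) (the number of edges); so it suffices to minimise the number of
   used colours over colourings into 'I_('C(n,2)).  When l <= 'C(k,2) the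
   injective colouring is good, so the minimum is over a nonempty family
   (the default value 'C(n,2) of the fold is then never below the minimum). *)
Definition fcol (n k l : nat) : nat :=
  \big[minn/'C(n, 2)]_(chi : coloring n 'C(n, 2) | good_coloring k l chi)
     #|used_colors chi|.

(* Main.v *)
Require Import Defs.
From mathcomp Require Import all_boot zify.
From Stdlib Require Import Reals Lra.
Set Implicit Arguments. Unset Strict Implicit. Unset Printing Implicit Defensive.

(** Let [chi] be a coloring in which every [k] vertices span more than
    [C(k,2) - k/2] colors.  No color has [k/2 + 1] edges at one vertex, so a
    maximal family [E] of edges whose color classes are matchings contains a
    positive proportion of all edges; discard the small classes.  In the color
    energy graph on pairs of vertices, [(a,b)] and [(x,y)] are adjacent when
    [ax] and [by] are distinct edges of [E] of the same color.

    This graph has girth greater than [k/2].  Indeed, suppose that [X] is a set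
    of at most [k/2] pairs inducing minimum degree at least 2.  The coordinates
    [U] of [X] and the edges [F] of [K_n] that it uses satisfy [|U| <= |F|],
    since the color classes are matchings and so [F] also has minimum degree at
    least 2, and each color of [F] occurs at least twice, so that
    [|F| - |chi F| >= |F|/2 >= |U|/2].  Adding to [U] disjoint further edges of
    one of these colors, each contributing two vertices and one repetition,
    leads to [k] vertices with [k/2] repetitions.

    With [p] colors the average degree is of order at least [n^2/p], and the Moore
    bound for girth greater than [2m], where [m = k/4], gives
    [(n^2/p)^m = O(n^2)]. *)

(** * The Moore bound by counting non-backtracking walks *)

(** A smallest [S] with more than [2 * d * #|S|] ordered adjacent pairs works: deleting a vertex
    with at most [d] neighbors loses at most [2 * d] pairs. *)
Lemma dense_subgraph (T : finType) (e : rel T) (d : nat) :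
  symmetric e ->
  2 * d * #|T| < #|[set p : T * T | e p.1 p.2]| ->
  exists S : {set T}, S != set0 /\
    forall v, v \in S -> d < #|[set w in S | e v w]|.
Proof.
move=> e_sym dense.
pose inner (S : {set T}) := [set p : T * T | [&& p.1 \in S, p.2 \in S & e p.1 p.2]].
pose P (S : {set T}) := 2 * d * #|S| < #|inner S|.
have PT : P setT.
  rewrite /P cardsT; apply: leq_trans dense _.
  by apply/subset_leq_card/subsetP => p; rewrite !inE.
case: (arg_minnP (fun S : {set T} => #|S|) PT) => S PS minS.
exists S; split.
  apply: contraTneq PS => ->; rewrite /P cards0 muln0 -leqNgt leqn0 cards_eq0.
  by apply/eqP/setP => p; rewrite !inE.
move=> v vS; rewrite ltnNge; apply/negP => low.
set N := [set w in S | e v w] in low.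
have : P (S :\ v).
  have sub : inner S \subset
      inner (S :\ v) :|: ([set (v, w) | w in N] :|: [set (w, v) | w in N]).
    apply/subsetP => -[a b]; rewrite !inE /= => /and3P[aS bS eab].
    have [av|nav] := eqVneq a v.
      apply/orP; right; apply/orP; left.
      by apply/imsetP; exists b; rewrite ?inE ?bS -?av.
    have [bv|nbv] := eqVneq b v.
      apply/orP; right; apply/orP; right.
      by apply/imsetP; exists a; rewrite ?inE ?aS -?bv ?[e b a]e_sym.
    by rewrite aS bS eab.
  have := subset_leq_card sub; rewrite !cardsU.
  have := leq_imset_card (fun w => (v, w)) N.
  have := leq_imset_card (fun w => (w, v)) N.
  move: PS; rewrite /P (cardsD1 v S) vS /=.
  nia.
by move=> /minS; rewrite (cardsD1 v S) vS /= add1n ltnn.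
Qed.

(* [x :: p] is a walk that never backtracks; [u] is the vertex preceding [x]. *)
Fixpoint nbwalk (T : finType) (e : rel T) (S : {set T}) (u x : T) (p : seq T) : bool :=
  if p is y :: p' then [&& y \in S, e x y, y != u & nbwalk e S x y p'] else true.

Lemma nbwalk_rcons (T : finType) (e : rel T) (S : {set T}) u x p z :
  nbwalk e S u x (rcons p z) -> nbwalk e S u x p /\ e (last x p) z.
Proof.
elim: p u x => [|y p IH] u x /=; first by case/and4P.
by case/and4P => -> -> -> /IH.
Qed.

(** The predecessor and the successor on the walk serve as neighbors; they differ because the walk
    does not backtrack. *)
Lemma nbwalk_inner (T : finType) (e : rel T) (S : {set T}) u x p z :
  symmetric e -> e u x -> nbwalk e S u x (rcons p z) ->
  forall v, v \in x :: p ->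
    exists a b, [/\ a \in [:: u, x & rcons p z], b \in [:: u, x & rcons p z],
                    a != b & e v a && e v b].
Proof.
move=> e_sym; elim: p u x => [|y p IH] u x eux /=.
  case/and4P => _ exz nzu _ v; rewrite inE => /eqP ->; exists u, z.
  by split; rewrite ?inE ?mem_rcons ?eqxx ?orbT ?exz ?[e x u]e_sym ?eux // eq_sym.
case/and4P => _ exy nyu walk v; rewrite inE => /predU1P[->|].
  exists u, y.
  by split; rewrite ?inE ?eqxx ?orbT ?exy ?[e x u]e_sym ?eux // eq_sym.
move=> inv; have [a [b [ina inb nab eab]]] := IH x y exy walk v inv; exists a, b.
by split => //; rewrite inE ?ina ?inb orbT.
Qed.

(* Two such walks contain a cycle, found after stripping their common end; the
   conclusion only records that its vertex set has minimum degree 2. *)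
Lemma two_nbwalks_core (T : finType) (e : rel T) (S : {set T}) x y y' p q :
  symmetric e -> e x y -> e x y' -> y != y' -> size p = size q ->
  nbwalk e S x y p -> nbwalk e S x y' q -> last y p = last y' q ->
  exists X : {set T}, [/\ X != set0, #|X| <= 2 * (size p).+1
    & forall v, v \in X -> 1 < #|[set w in X | e v w]|].
Proof.
move=> e_sym exy exy' nyy'; elim/last_ind: p q => [|p z IH] q.
  by case: q => //= _ _ _ Eyy'; rewrite Eyy' eqxx in nyy'.
case/lastP: q => [|q z']; rewrite !size_rcons // => -[szpq] wp wq.
rewrite !last_rcons => Ez; rewrite -{}Ez in wq *.
have [wp' ep] := nbwalk_rcons wp.
have [wq' eq] := nbwalk_rcons wq.
(* If the walks agree just before [z], drop [z] and recurse; otherwise [z] has two distinct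
   neighbors. *)
have [Elast|nlast] := eqVneq (last y p) (last y' q).
  have [X [X0 szX degX]] := IH q szpq wp' wq' Elast.
  by exists X; split => //; apply: leq_trans szX _; rewrite leq_mul2l leqnSn.
pose s := [:: x, z & (y :: p) ++ (y' :: q)].
pose X := [set v in s].
have inX v : (v \in X) = (v \in s) by rewrite inE.
have deg2 v a b : a \in s -> b \in s -> a != b -> e v a && e v b ->
    1 < #|[set w in X | e v w]|.
  move=> sa sb nab /andP[eva evb]; apply/card_gt1P; exists a, b.
  by rewrite inE inX sa eva inE inX sb evb.
exists X; split.
- by apply/set0Pn; exists x; rewrite inX inE eqxx.
- rewrite cardsE; apply: leq_trans (card_size s) _.
  by rewrite /s /= size_cat /= -szpq mul2n -addnn !addSn !addnS.
move=> v; rewrite inX inE => /predU1P[->|].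
  by apply: (deg2 _ y y'); rewrite ?exy ?exy' // !(inE, mem_cat) eqxx ?orbT.
rewrite inE => /predU1P[->|].
  apply: (deg2 _ (last y p) (last y' q)) => //; last by rewrite e_sym ep e_sym eq.
  - by rewrite 2!inE mem_cat mem_last !orbT.
  - by rewrite 2!inE mem_cat mem_last !orbT.
rewrite mem_cat => /orP[] inv.
- have [a [b [ina inb nab eab]]] := nbwalk_inner e_sym exy wp inv.
  by apply: (deg2 _ a b) => //; [move: ina | move: inb];
    rewrite !(inE, mem_rcons, mem_cat) => /or4P[] ->; rewrite ?orbT.
- have [a [b [ina inb nab eab]]] := nbwalk_inner e_sym exy' wq inv.
  by apply: (deg2 _ a b) => //; [move: ina | move: inb];
    rewrite !(inE, mem_rcons, mem_cat) => /or4P[] ->; rewrite ?orbT.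
Qed.

Fixpoint nbreach (T : finType) (e : rel T) (S : {set T}) (l : nat) (u x : T) : {set T} :=
  if l is l'.+1 then
    \bigcup_(y in [set y in S | e x y] :\ u) nbreach e S l' x y
  else [set x].

Lemma nbreachP (T : finType) (e : rel T) (S : {set T}) l u x z :
  z \in nbreach e S l u x ->
  exists p, [/\ size p = l, nbwalk e S u x p & last x p = z].
Proof.
elim: l u x => [|l IH] u x /=; first by rewrite inE => /eqP ->; exists [::].
case/bigcupP => y; rewrite !inE => /and3P[nyu yS exy] /IH[p [szp wp lp]].
by exists (y :: p); rewrite /= szp yS exy nyu.
Qed.

(** Without a small core, walks of equal length through distinct neighbors of [x] never meet, so
    each step multiplies the number of endpoints by at least [d]. *)
Lemma moore_bound (T : finType) (e : rel T) (d m : nat) :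
  symmetric e ->
  2 * d * #|T| < #|[set p : T * T | e p.1 p.2]| -> #|T| < expn d m ->
  exists X : {set T}, [/\ X != set0, #|X| <= 2 * m
    & forall v, v \in X -> 1 < #|[set w in X | e v w]|].
Proof.
move=> e_sym /dense_subgraph-/(_ e_sym)[S [/set0Pn[x0 x0S] degS]] ltTd.
have [/existsP[X /and3P[X0 szX /forall_inP degX]]|noX] :=
  boolP [exists X : {set T}, [&& X != set0, #|X| <= 2 * m
    & [forall v in X, 1 < #|[set w in X | e v w]|]]]; first by exists X.
suff H l u x : x \in S -> l <= m -> expn d l <= #|nbreach e S l u x|.
  by have := leq_trans (H m x0 x0 x0S (leqnn m)) (max_card _); rewrite leqNgt ltTd.
elim: l u x => [|l IH] u x xS lm /=; first by rewrite cards1.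
set Y := _ :\ u.
(* Padding with [set0] outside [Y] makes the family disjoint over all of [T]. *)
pose F y := if y \in Y then nbreach e S l x y else set0.
have disj y y' : y != y' -> [disjoint F y & F y'].
  move=> nyy'; rewrite /F; case: ifP => Yy; last by rewrite -setI_eq0 set0I.
  case: ifP => Yy'; last by rewrite -setI_eq0 setI0.
  apply/pred0P => z /=; apply/negbTE/negP => /andP[].
  move=> /nbreachP[p [szp wp lp]] /nbreachP[q [szq wq lq]].
  move: Yy Yy'; rewrite !inE => /and3P[_ _ exy] /and3P[_ _ exy'].
  have [] := two_nbwalks_core e_sym exy exy' nyy' _ wp wq _.
  - by rewrite szp szq.
  - by rewrite lp lq.
  move=> X [X0 szX degX]; case/existsP: noX; exists X; rewrite X0 /=.
  apply/andP; split; last by apply/forall_inP.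
  by apply: leq_trans szX _; rewrite leq_mul2l szp lm.
have -> : \bigcup_(y in Y) nbreach e S l x y = \bigcup_y F y.
  by rewrite big_mkcond.
rewrite -sum1_card (partition_disjoint_bigcup _ (fun _ => 1)) //.
apply: (@leq_trans (\sum_(y in Y) expn d l)).
  rewrite sum_nat_const expnS leq_mul2r; apply/orP; right.
  (* The degree exceeds [d], so at least [d] neighbors remain after excluding [u]. *)
  have := degS x xS; rewrite (cardsD1 u) -/Y.
  by case: (u \in _) => /=; lia.
rewrite big_mkcond /=; apply: leq_sum => y _; rewrite /F sum1_card.
case: ifP => // Yy; apply: IH; last by apply: ltnW.
by move: Yy; rewrite !inE => /and3P[].
Qed.

(* [lia] may fail to identify equal cardinals unless they are abstracted first. *)
Ltac card_lia :=
  repeat match goal with H : context [#|?A|] |- _ => move: H end;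
  repeat (let c := fresh "c" in set c := #|_|; move: c => c);
  lia.

(** * Color repetitions inside a set of vertices *)

(** The number of repetitions [#|A| - #|f @: A|] is monotone in [A], since each new element creates
    at most one new value. *)
Lemma card_imset_add (aT rT : finType) (f : aT -> rT) (A B : {set aT}) :
  A \subset B -> #|f @: B| + #|A| <= #|f @: A| + #|B|.
Proof.
move=> AB.
have EB : B = A :|: (B :\: A) by rewrite -{1}(setID B A) (setIidPr AB).
rewrite -(cardsID A B) (setIidPr AB) {1}EB imsetU cardsU.
have := leq_imset_card f (B :\: A); lia.
Qed.

Lemma exists_superset_card (T : finType) (A : {set T}) (k : nat) :
  #|A| <= k <= #|T| -> exists B : {set T}, A \subset B /\ #|B| = k.
Proof.
elim: k => [|k IH] /andP[Ak kT].
  by exists A; split => //; lia.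
move: Ak; rewrite leq_eqVlt => /predU1P[Ak|Ak]; first by exists A.
have [|B [AB szB]] := IH; first by rewrite -ltnS Ak ltnW.
have : 0 < #|~: B| by have := cardsC B; lia.
case/card_gt0P => x; rewrite inE => xB; exists (x |: B); split.
  by apply: subset_trans AB (subsetU1 _ _).
by rewrite cardsU1 xB szB.
Qed.

Definition edges_in n (S : {set 'I_n}) : {set 'I_n * 'I_n} :=
  [set p | [&& p.1 \in S, p.2 \in S & p.1 < p.2]].

Lemma edges_inS n (S S' : {set 'I_n}) : S \subset S' -> edges_in S \subset edges_in S'.
Proof.
move=> /subsetP sub; apply/subsetP => p; rewrite !inE => /and3P[p1 p2 ->].
by rewrite !sub.
Qed.

(** The square of [S] splits into increasing pairs, their mirror images and the diagonal. *)
Lemma card_edges_in n (S : {set 'I_n}) : #|edges_in S| = 'C(#|S|, 2).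
Proof.
have sq : #|S| * #|S| = #|edges_in S| + (#|edges_in S| + #|S|).
  rewrite -cardsX -(cardsID [set p : 'I_n * 'I_n | p.1 < p.2] (setX S S)); congr (_ + _).
    by apply: eq_card => p; rewrite !inE -andbA.
  rewrite -(cardsID [set p : 'I_n * 'I_n | p.2 < p.1] (setX S S :\: _)); congr (_ + _).
    rewrite -[RHS](@card_imset _ _ (fun p => (p.2, p.1))); last by move=> [? ?] [? ?] [-> ->].
    apply: eq_card => -[a b]; rewrite !inE /=; apply/idP/imsetP.
      move=> /andP[/and3P[_ aS bS] ba]; exists (b, a) => //=.
      by rewrite inE /= aS bS ba.
    case=> -[c d]; rewrite inE /= => /and3P[cS dS cd] [-> ->].
    by rewrite cS dS cd -leqNgt ltnW.
  rewrite -[RHS](@card_imset _ _ (fun x => (x, x))); last by move=> ? ? [].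
  apply: eq_card => -[a b]; rewrite !inE /=; apply/idP/imsetP.
    case/and4P => ba ab aS bS; exists a => //; congr (_, _); apply: val_inj => /=.
    lia.
  by case=> c cS [-> ->]; rewrite ltnn cS.
rewrite bin2; case: #|S| sq => [|s] /=; lia.
Qed.

(** Enlarge [U] to exactly [k] vertices: these have fewer than [k %/ 2] repetitions, and [F] has no
    more. *)
Lemma good_coloring_repeats n M k (chi : coloring n M)
    (F : {set 'I_n * 'I_n}) (U : {set 'I_n}) :
  good_coloring k ('C(k, 2) - k %/ 2 + 1) chi -> k <= n ->
  #|U| <= k -> F \subset edges_in U -> #|F| < #|chi @: F| + k %/ 2.
Proof.
move=> good kn Uk FU.
have [|S [US szS]] := @exists_superset_card _ U k; first by rewrite Uk card_ord.
have := forallP good S; rewrite szS eqxx /=.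
have -> : spanned_colors chi S = chi @: edges_in S.
  by rewrite /spanned_colors; apply: eq_imset => // p; rewrite !inE.
have := card_imset_add chi (subset_trans FU (edges_inS US)).
rewrite card_edges_in szS => le_repeats many_colors.
have := leq_trans (leq_add many_colors (leqnn #|F|)) le_repeats.
card_lia.
Qed.

(** A star of [k %/ 2 + 1] edges in one color would have [k %/ 2] repetitions on at most
    [k %/ 2 + 2 <= k] vertices. *)
Lemma monochromatic_star n M k (chi : coloring n M) (a : 'I_n) (c : 'I_M) :
  good_coloring k ('C(k, 2) - k %/ 2 + 1) chi -> k <= n -> 4 <= k ->
  #|[set p in edges_in setT | (chi p == c) && ((p.1 == a) || (p.2 == a))]| <= k %/ 2.
Proof.
move=> good kn k4; rewrite leqNgt; apply/negP => /card_geqP[s [us szs subs]].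
pose F := [set p in s].
have cF : #|F| = (k %/ 2).+1 by rewrite cardsE (card_uniqP us).
pose other (p : 'I_n * 'I_n) := if p.1 == a then p.2 else p.1.
have := @good_coloring_repeats n M k chi F (a |: other @: F) good kn.
have chiF : #|chi @: F| <= 1.
  rewrite -(cards1 c); apply/subset_leq_card/subsetP => _ /imsetP[p pF ->].
  by move: pF; rewrite !inE => /subs; rewrite !inE => /andP[_ /andP[]].
have szU : #|a |: other @: F| <= k.
  rewrite cardsU1; have := leq_imset_card other F; rewrite cF; case: (_ \in _) => /=; card_lia.
move/(_ szU); rewrite cF => /implyP.
suff -> : F \subset edges_in (a |: other @: F) by rewrite /=; card_lia.
apply/subsetP => p pF; move: (pF); rewrite inE => /subs; rewrite !inE /=.
case/andP => -> /andP[_ end_a]; rewrite andbT.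
have : other p \in other @: F by apply: imset_f.
have other1 : p.1 == a -> other p = p.2 by rewrite /other => ->.
have other2 : p.1 != a -> other p = p.1 by rewrite /other => /negbTE ->.
case: (boolP (p.1 == a)) end_a => [pa _ | pna /= ->].
  by rewrite other1 // => ->; rewrite orbT.
by rewrite other2 // => ->.
Qed.

(** * Edge families whose color classes are matchings *)

(** Equal arguments give a diagonal pair, which lies in no [edges_in]. *)
Definition sorted_pair n (a x : 'I_n) := if a < x then (a, x) else (x, a).

Lemma sorted_pairC n (a x : 'I_n) : sorted_pair a x = sorted_pair x a.
Proof. by rewrite /sorted_pair; case: ltngtP => // /val_inj ->. Qed.


Definition share n (p q : 'I_n * 'I_n) :=
  [|| p.1 == q.1, p.1 == q.2, p.2 == q.1 | p.2 == q.2].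

Lemma share_sym n (p q : 'I_n * 'I_n) : share p q = share q p.
Proof.
rewrite /share (eq_sym q.1 p.1) (eq_sym q.1 p.2) (eq_sym q.2 p.1) (eq_sym q.2 p.2).
by congr (_ || _); rewrite orbCA.
Qed.

Definition color_matchings n M (chi : coloring n M) (E : {set 'I_n * 'I_n}) :=
  [forall p in E, forall q in E, (chi p == chi q) && share p q ==> (p == q)].

Lemma color_matchingsP n M (chi : coloring n M) (E : {set 'I_n * 'I_n}) :
  reflect (forall p q, p \in E -> q \in E -> chi p = chi q -> share p q -> p = q)
          (color_matchings chi E).
Proof.
apply: (iffP forall_inP) => [H p q pE qE chipq sh|H p pE].
  by have := forall_inP (H p pE) q qE; rewrite chipq eqxx sh => /eqP.
by apply/forall_inP => q qE; apply/implyP => /andP[/eqP ? ?]; apply/eqP/H.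
Qed.

(** For [E] of maximum size, every edge lies in a monochromatic star, of the color of some [q] in
    [E], centered at an end of [q]. Each [q] gives two stars of at most [k %/ 2] edges. *)
Lemma exists_color_matchings n M k (chi : coloring n M) :
  good_coloring k ('C(k, 2) - k %/ 2 + 1) chi -> k <= n -> 4 <= k ->
  exists E : {set 'I_n * 'I_n},
    [/\ E \subset edges_in setT, color_matchings chi E & 'C(n, 2) <= k * #|E|].
Proof.
move=> good kn k4.
pose P (E : {set 'I_n * 'I_n}) := (E \subset edges_in setT) && color_matchings chi E.
have P0 : P set0.
  by rewrite /P sub0set; apply/color_matchingsP => p q; rewrite inE.
case: (arg_maxnP (fun E : {set 'I_n * 'I_n} => #|E|) P0) => E /andP[EE cmE] maxE.
exists E; split => //.
pose star a c := [set p in edges_in [set: 'I_n] | (chi p == c) && ((p.1 == a) || (p.2 == a))].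
have cover : edges_in setT \subset
    \bigcup_(q in E) (star q.1 (chi q) :|: star q.2 (chi q)).
  apply/subsetP => p pE.
  have star_mem q : q \in E -> chi p = chi q -> share p q ->
      p \in \bigcup_(q in E) (star q.1 (chi q) :|: star q.2 (chi q)).
    move=> qE chipq sh; apply/bigcupP; exists q => //.
    by rewrite !inE; move: pE; rewrite !inE => ->; rewrite chipq eqxx /=; move: sh;
      rewrite /share => /or4P[] ->; rewrite ?orbT.
  have [pinE|pnE] := boolP (p \in E).
    by apply: (star_mem p) => //; rewrite /share eqxx.
  have [/existsP[q /and3P[qE /eqP chipq sh]]|none] :=
    boolP [exists q, [&& q \in E, chi p == chi q & share p q]].
    exact: star_mem qE chipq sh.
  have none' q : q \in E -> chi p = chi q -> share p q -> False.
    by move=> qE chipq sh; case/existsP: none; exists q; rewrite qE chipq eqxx sh.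
  have : P (p |: E).
    rewrite /P subUset sub1set pE EE /=; apply/color_matchingsP => q q'.
    rewrite !inE => /predU1P[->|qE] /predU1P[->|q'E] //.
    - by move=> h1 h2; case: (none' q').
    - by move=> h1 h2; case: (none' q); rewrite ?h1 1?share_sym.
    - by apply: (color_matchingsP _ _ cmE).
  by move/maxE; rewrite cardsU1 pnE /= add1n ltnn.
have := subset_leq_card cover; rewrite card_edges_in cardsT card_ord => /leq_trans; apply.
apply: (@leq_trans (\sum_(q in E) k)); last by rewrite sum_nat_const mulnC.
apply: (big_ind2 (fun (A : {set 'I_n * 'I_n}) b => #|A| <= b)); first by rewrite cards0.
  by move=> A a B b Aa Bb; rewrite cardsU; card_lia.
move=> q _; rewrite cardsU.
have := monochromatic_star q.1 (chi q) good kn k4.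
have := monochromatic_star q.2 (chi q) good kn k4.
rewrite -!/(star _ _); card_lia.
Qed.

(** Adding an edge of the color of [p] disjoint from [U] raises both sides of the inequality by 2,
    so a failure would persist until [k] vertices have too many repetitions. *)
Lemma repeats_extend n M k (chi : coloring n M) (E F : {set 'I_n * 'I_n}) p U :
  good_coloring k ('C(k, 2) - k %/ 2 + 1) chi -> k <= n ->
  color_matchings chi E -> E \subset edges_in setT ->
  p \in F -> k <= #|[set q in E | chi q == chi p]| ->
  F \subset edges_in U -> #|U| <= k -> 2 * #|F| < 2 * #|chi @: F| + #|U|.
Proof.
move=> good kn cmE EE pF big_color.
have [j] := ubnP (k - #|U|); elim: j U F pF => // j IH U F pF szU FU Uk.
rewrite ltnNge; apply/negP => manyrep.
have few := good_coloring_repeats good kn Uk FU.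
have Uk2 : #|U| + 2 <= k by card_lia.
have [/existsP[q /and4P[qE /eqP chiq q1 q2]]|none] :=
  boolP [exists q, [&& q \in E, chi q == chi p, q.1 \notin U & q.2 \notin U]].
  have q12 : q.1 < q.2 by have := subsetP EE q qE; rewrite !inE.
  have nq12 : q.1 != q.2 by rewrite neq_ltn q12.
  have szU' : #|q.1 |: (q.2 |: U)| = #|U| + 2.
    by rewrite !cardsU1 q2 !inE negb_or nq12 q1 /= addnA addnC.
  have qF : q \notin F.
    by apply: contra q1 => /(subsetP FU); rewrite inE => /andP[].
  have chiF : chi @: (q |: F) = chi @: F.
    rewrite imsetU1 chiq; apply/setUidPr; rewrite sub1set; exact: imset_f.
  have := IH (q.1 |: (q.2 |: U)) (q |: F).
  rewrite szU' chiF cardsU1 qF inE pF orbT => /(_ isT).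
  have -> : q |: F \subset edges_in (q.1 |: (q.2 |: U)).
    rewrite subUset sub1set !inE !eqxx q12 !orbT /=.
    apply: subset_trans FU _; apply: edges_inS.
    exact: subset_trans (subsetU1 _ _) (subsetU1 _ _).
  move=> /(_ _ isT Uk2) H; move: H szU manyrep Uk2; clear; card_lia.
(* With no disjoint edge left, the matching of this color injects into [U], so [#|U|] is at least
   [k], a contradiction. *)
have hit q : q \in E -> chi q = chi p -> (q.1 \in U) || (q.2 \in U).
  move=> qE chiq; apply: contraNT none; rewrite negb_or => /andP[q1 q2].
  by apply/existsP; exists q; rewrite qE chiq eqxx q1 q2.
pose vtx (q : 'I_n * 'I_n) := if q.1 \in U then q.1 else q.2.
have inj : {in [set q in E | chi q == chi p] &, injective vtx}.
  move=> q q'; rewrite !inE => /andP[qE /eqP cq] /andP[q'E /eqP cq'] Evtx.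
  apply: (color_matchingsP _ _ cmE) => //; first by rewrite cq.
  by move: Evtx; rewrite /vtx /share; do 2 case: ifP => _; move=> ->; rewrite eqxx ?orbT.
have sub : vtx @: [set q in E | chi q == chi p] \subset U.
  apply/subsetP => v /imsetP[q]; rewrite inE => /andP[qE /eqP cq] ->.
  by rewrite /vtx; have := hit q qE cq; case: ifP.
have := subset_leq_card sub; rewrite (card_in_imset inj) => /(leq_trans big_color).
by move=> /(leq_trans Uk2); rewrite -[leqRHS]addn0 leq_add2l.
Qed.

(** * The color energy graph has no small core *)

Definition color_energy_graph n M (chi : coloring n M) (E : {set 'I_n * 'I_n})
    (v w : 'I_n * 'I_n) :=
  let p := sorted_pair v.1 w.1 in let q := sorted_pair v.2 w.2 in
  [&& p \in E, q \in E, p != q & chi p == chi q].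

Lemma color_energy_graph_sym n M (chi : coloring n M) (E : {set 'I_n * 'I_n}) :
  symmetric (color_energy_graph chi E).
Proof.
move=> v w; rewrite /color_energy_graph.
by rewrite (sorted_pairC w.1) (sorted_pairC w.2).
Qed.

Lemma sorted_pair_share n (a x y : 'I_n) : share (sorted_pair a x) (sorted_pair a y).
Proof. by rewrite /share /sorted_pair; do 2 case: ifP => _ /=; rewrite eqxx ?orbT. Qed.

Lemma sorted_pair_inj n (a : 'I_n) : injective (sorted_pair a).
Proof.
move=> x y; rewrite /sorted_pair.
by do 2 case: ifP => _; case=> *; congruence.
Qed.

Lemma color_energy_core n M k (chi : coloring n M) (E X : {set 'I_n * 'I_n}) :
  good_coloring k ('C(k, 2) - k %/ 2 + 1) chi -> k <= n ->
  color_matchings chi E -> E \subset edges_in setT ->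
  (forall p, p \in E -> k <= #|[set q in E | chi q == chi p]|) ->
  X != set0 -> 2 * #|X| <= k ->
  ~ forall v, v \in X -> 1 < #|[set w in X | color_energy_graph chi E v w]|.
Proof.
move=> good kn cmE EE big_color /set0Pn[v0 v0X] szX deg.
set e := color_energy_graph chi E in deg *.
pose Y := [set vw | [&& vw.1 \in X, vw.2 \in X & e vw.1 vw.2]].
pose f1 (vw : ('I_n * 'I_n) * ('I_n * 'I_n)) := sorted_pair vw.1.1 vw.2.1.
pose f2 (vw : ('I_n * 'I_n) * ('I_n * 'I_n)) := sorted_pair vw.1.2 vw.2.2.
pose F := f1 @: Y :|: f2 @: Y.
pose U := [set v.1 | v in X] :|: [set v.2 | v in X].
have FE : F \subset E.
  by apply/subsetP => p /setUP[] /imsetP[vw]; rewrite inE => /and3P[_ _ /and4P[? ? _ _]] ->.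
have szU : #|U| <= k.
  rewrite cardsU; have := leq_imset_card (fun v : 'I_n * 'I_n => v.1) X.
  have := leq_imset_card (fun v : 'I_n * 'I_n => v.2) X; card_lia.
have FU : F \subset edges_in U.
  apply/subsetP => p pF; have := subsetP EE p (subsetP FE p pF).
  rewrite !inE /= => p12; rewrite p12 andbT.
  have in1 v : v \in X -> v.1 \in U by move=> vX; apply/setUP; left; apply: imset_f.
  have in2 v : v \in X -> v.2 \in U by move=> vX; apply/setUP; right; apply: imset_f.
  suff : (p.1 \in U) && (p.2 \in U) by rewrite !inE.
  case/setUP: pF => /imsetP[[v w]]; rewrite inE /= => /and3P[vX wX _] ->;
    by rewrite /f1 /f2 /sorted_pair /=; case: ifP => _ /=; rewrite ?in1 ?in2.
(* Two neighbors of [v] give two edges at [u]. Were these equal, their partners at the other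
   coordinate of [v] would share a color and an end, hence coincide, and so would the neighbors. *)
have degU u : u \in U -> 1 < #|[set p in F | (p.1 == u) || (p.2 == u)]|.
  have incident x : (sorted_pair u x).1 == u \/ (sorted_pair u x).2 == u.
    by rewrite /sorted_pair; case: ifP => _; rewrite eqxx; [left | right].
  case/setUP => /imsetP[v vX Eu]; have /card_gt1P[w [w' [win w'in nww']]] := deg v vX.
  - move: win w'in; rewrite !inE => /andP[wX evw] /andP[w'X evw'].
    apply/card_gt1P; exists (f1 (v, w)), (f1 (v, w')).
    have inF z : z \in X -> e v z ->
        f1 (v, z) \in [set p in F | (p.1 == u) || (p.2 == u)].
      move=> zX evz; rewrite inE; apply/andP; split.
        by apply/setUP; left; apply: imset_f; rewrite inE /= vX zX.
      by rewrite /f1 /= -Eu; apply/orP/incident.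
    split; [exact: inF | exact: inF |].
    apply: contra nww' => /eqP Ef; move: evw evw' => /and4P[/= _ E2 _ c12] /and4P[/= _ E2' _ c12'].
    have Ef2 : f2 (v, w) = f2 (v, w').
      apply: (color_matchingsP _ _ cmE) => //; last exact: sorted_pair_share.
      by rewrite -(eqP c12) -(eqP c12'); congr (chi _).
    by rewrite -pair_eqE /pair_eq (sorted_pair_inj Ef) (sorted_pair_inj Ef2) !eqxx.
  - move: win w'in; rewrite !inE => /andP[wX evw] /andP[w'X evw'].
    apply/card_gt1P; exists (f2 (v, w)), (f2 (v, w')).
    have inF z : z \in X -> e v z ->
        f2 (v, z) \in [set p in F | (p.1 == u) || (p.2 == u)].
      move=> zX evz; rewrite inE; apply/andP; split.
        by apply/setUP; right; apply: imset_f; rewrite inE /= vX zX.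
      by rewrite /f2 /= -Eu; apply/orP/incident.
    split; [exact: inF | exact: inF |].
    apply: contra nww' => /eqP Ef; move: evw evw' => /and4P[/= E1 _ _ c12] /and4P[/= E1' _ _ c12'].
    have Ef1 : f1 (v, w) = f1 (v, w').
      apply: (color_matchingsP _ _ cmE) => //; last exact: sorted_pair_share.
      by rewrite (eqP c12) (eqP c12'); congr (chi _).
    by rewrite -pair_eqE /pair_eq (sorted_pair_inj Ef) (sorted_pair_inj Ef1) !eqxx.
(* Double counting of incidences between [U] and [F]. *)
have UF : #|U| <= #|F|.
  have inc1 (a : 'I_n) : \sum_(u in U) (a == u) <= 1.
    apply: (@leq_trans (\sum_u (a == u))); first by rewrite [leqRHS](bigID (mem U)) leq_addr.
    by rewrite (bigD1 a) //= eqxx big1 // => u; rewrite eq_sym => /negbTE ->.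
  have up : \sum_(u in U) \sum_(p in F) ((p.1 == u) + (p.2 == u)) <= 2 * #|F|.
    rewrite exchange_big mulnC -sum_nat_const; apply: leq_sum => p _.
    by rewrite big_split (leq_add (inc1 _) (inc1 _)).
  have low : 2 * #|U| <= \sum_(u in U) \sum_(p in F) ((p.1 == u) + (p.2 == u)).
    rewrite mulnC -sum_nat_const; apply: leq_sum => u /degU /leq_trans; apply.
    rewrite -sum1_card big_mkcond [leqRHS]big_mkcond /=; apply: leq_sum => p _.
    by rewrite inE; case: (p \in F) => //=; do 2 case: (_ == u).
  by rewrite -(leq_pmul2l (isT : 0 < 2)) (leq_trans low up).
have chi2 : 2 * #|chi @: F| <= #|F|.
  rewrite -[leqRHS]sum1_card (partition_big_imset chi) /= mulnC -sum_nat_const.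
  apply: leq_sum => c /imsetP[p pF ->]; rewrite sum1_card.
  have two vw : vw \in Y -> 1 < #|[pred q | (q \in F) && (chi q == chi (f1 vw))]|.
    move=> vwY; apply/card_gt1P; exists (f1 vw), (f2 vw).
    have F1 : f1 vw \in F by apply/setUP; left; apply: imset_f.
    have F2 : f2 vw \in F by apply/setUP; right; apply: imset_f.
    move: vwY; rewrite inE => /and3P[_ _ /and4P[_ _ n12 c12]].
    by split => //; rewrite inE ?F1 ?F2 ?eqxx //= eq_sym.
  case/setUP: pF => /imsetP[vw vwY ->]; first exact: two.
  have -> : chi (f2 vw) = chi (f1 vw).
    by move: vwY; rewrite inE => /and3P[_ _ /and4P[_ _ _ /eqP]].
  exact: two.
(* Any edge of [F] can supply the color used for the extension. *)
have /card_gt0P[w] : 0 < #|[set w in X | e v0 w]| by apply: ltnW; apply: deg.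
rewrite inE => /andP[wX ev0w].
have pF : f1 (v0, w) \in F.
  by apply/setUP; left; apply: imset_f; rewrite inE /= v0X wX.
have := repeats_extend good kn cmE EE pF (big_color _ (subsetP FE _ pF)) FU szU.
move: UF chi2; clear; card_lia.
Qed.

(** * Density of the color energy graph *)

Lemma sqr_le_bin2 (n : nat) : 1 < n -> n * n <= 4 * 'C(n, 2).
Proof.
move=> n2; rewrite bin2; case: n n2 => // n n2 /=.
have : (n.+1 * n)./2.*2 = n.+1 * n by rewrite even_halfK // oddM /= andNb.
by nia.
Qed.

Lemma card_sum_fibers (aT rT : finType) (A : {set aT}) (B : aT -> {set rT}) :
  #|[set x : aT * rT | (x.1 \in A) && (x.2 \in B x.1)]| = \sum_(a in A) #|B a|.
Proof.
under [RHS]eq_bigr do rewrite -sum1_card.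
by rewrite pair_big_dep -sum1_card; apply: eq_bigl => x; rewrite inE.
Qed.

Lemma rich_colors n M (chi : coloring n M) (E : {set 'I_n * 'I_n}) (L : nat) :
  E \subset edges_in setT ->
  #|E| <= #|[set p in E | L <= #|[set q in E | chi q == chi p]|]| + L * #|used_colors chi|.
Proof.
move=> EE; set E' := [set p in E | _].
have -> : #|E| = #|E'| + #|E :\: E'|.
  rewrite -(cardsID E' E) (setIidPr _) //; by apply/subsetP => p; rewrite inE => /andP[].
rewrite leq_add2l.
have sub : chi @: (E :\: E') \subset used_colors chi.
  apply/subsetP => c /imsetP[p /setDP[pE _] ->]; apply: imset_f.
  by have := subsetP EE p pE; rewrite !inE.
apply: leq_trans (leq_mul (leqnn L) (subset_leq_card sub)).
rewrite -[leqLHS]sum1_card (partition_big_imset chi) /= mulnC -sum_nat_const.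
apply: leq_sum => c /imsetP[p pE' ->]; rewrite sum1_card.
move: (pE'); rewrite !inE => /andP[+ pE]; rewrite pE /= -ltnNge => /ltnW; apply: leq_trans.
by apply: subset_leq_card; apply/subsetP => q /andP[/setDP[qE _] chiq]; rewrite inE qE.
Qed.

(** An ordered pair of distinct edges of one color yields an adjacency by pairing first ends and
    second ends; this map is injective. *)
Lemma color_energy_lower n M (chi : coloring n M) (E : {set 'I_n * 'I_n}) (L : nat) :
  E \subset edges_in setT ->
  (forall p, p \in E -> L < #|[set q in E | chi q == chi p]|) ->
  #|E| * L <=
    #|[set vw : ('I_n * 'I_n) * ('I_n * 'I_n) | color_energy_graph chi E vw.1 vw.2]|.
Proof.
move=> EE rich.
pose B p := [set q in E | chi q == chi p] :\ p.
apply: (@leq_trans (\sum_(p in E) #|B p|)).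
  rewrite -sum_nat_const; apply: leq_sum => p pE.
  by have := rich p pE; rewrite (cardsD1 p) inE pE eqxx.
rewrite -card_sum_fibers.
pose f (pq : ('I_n * 'I_n) * ('I_n * 'I_n)) := ((pq.1.1, pq.2.1), (pq.1.2, pq.2.2)).
have f_inj : injective f by move=> [[a x] [b y]] [[a' x'] [b' y']] [-> -> -> ->].
rewrite -[leqLHS](card_imset _ f_inj); apply/subset_leq_card/subsetP => vw /imsetP[[p q]].
rewrite !inE /= => /and4P[pE nqp qE chiqp] ->.
have sortE r : r \in E -> sorted_pair r.1 r.2 = r.
  move=> rE; have := subsetP EE r rE; rewrite !inE /sorted_pair /= => ->.
  by case: r {rE}.
by rewrite /color_energy_graph /= !sortE // pE qE eq_sym nqp eq_sym.
Qed.

Lemma color_energy_bound n M k m d (chi : coloring n M) :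
  good_coloring k ('C(k, 2) - k %/ 2 + 1) chi -> k <= n -> 4 <= k -> 4 * m <= k ->
  0 < d -> 144 * k * k * d * #|used_colors chi| <= n * n -> expn d m <= n * n.
Proof.
move=> good kn k4 mk d0 few.
have [E [EE cmE largeE]] := exists_color_matchings good kn k4.
(* The classes with at most [L] edges hold at most half of [E], because
   [8 * k * L.+1 <= 144 * k * k * d]. The factor 16 suits [n * n <= 8 * k * #|E'|], and the added 1
   makes the density bound strict. *)
pose L := 16 * k * d + 1.
pose E' := [set p in E | L.+1 <= #|[set q in E | chi q == chi p]|].
have E'E : E' \subset E by apply/subsetP => p; rewrite inE => /andP[].
have EE' := subset_trans E'E EE.
(* Classes are kept or discarded whole, so those that survive do not shrink. *)
have rich p : p \in E' -> L < #|[set q in E' | chi q == chi p]|.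
  rewrite inE => /andP[pE big]; apply: leq_trans (big) _.
  apply/subset_leq_card/subsetP => q; rewrite !inE => /andP[qE /eqP chiq].
  by rewrite qE chiq big /=.
have cmE' : color_matchings chi E'.
  apply/color_matchingsP => p q /(subsetP E'E) pE /(subsetP E'E) qE.
  exact: (color_matchingsP _ _ cmE).
have manyE' : 0 < #|E'| /\ n * n <= 8 * k * #|E'|.
  have := rich_colors chi L.+1 EE; rewrite -/E'.
  have : n * n <= 4 * 'C(n, 2).
    by apply: sqr_le_bin2; apply: leq_trans kn; apply: leq_trans k4.
  move: few largeE; rewrite /L; move: #|E| #|E'| #|used_colors chi| 'C(n, 2) => a b c e.
  move=> few largeE h1 h2.
  have h3 : 8 * k * (L.+1 * c) <= n * n.
    apply: leq_trans few; rewrite /L; nia.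
  have h4 : 8 * k * (L.+1 * c) <= 4 * k * a by nia.
  have h5 : 2 * (L.+1 * c) <= a.
    by rewrite -(@leq_pmul2l (4 * k)) ?muln_gt0 ?(leq_trans _ k4) //; lia.
  have h6 : a <= 2 * b by rewrite /L in h5; lia.
  split; nia.
have dense : 2 * d * #|{: 'I_n * 'I_n}| <
    #|[set vw : ('I_n * 'I_n) * ('I_n * 'I_n) | color_energy_graph chi E' vw.1 vw.2]|.
  apply: leq_trans (color_energy_lower EE' rich).
  rewrite card_prod card_ord; case: manyE'; rewrite /L; move: #|E'| => b; nia.
rewrite leqNgt; apply/negP => big.
have [|X [X0 szX degX]] := moore_bound (color_energy_graph_sym chi E') dense (m := m).
  by rewrite card_prod card_ord.
apply: (color_energy_core good kn cmE' EE' _ X0 _ degX).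
  by move=> p /rich; apply: leq_trans; rewrite /L; nia.
by apply: leq_trans mk; rewrite (_ : 4 = 2 * 2) // -mulnA leq_mul2l.
Qed.

(** * From the counting bound to the asymptotic estimate *)

Lemma fcol_attained (n k l : nat) :
  fcol n k l = 'C(n, 2) \/
  exists2 chi : coloring n 'C(n, 2), good_coloring k l chi & fcol n k l = #|used_colors chi|.
Proof.
rewrite /fcol; elim/big_rec: _ => [|chi x good [->|[chi' good' ->]]]; first by left.
- by rewrite /minn; case: ifP => _; [right; exists chi | left].
- by rewrite /minn; case: ifP => _; right; [exists chi | exists chi'].
Qed.

Lemma fcol_energy_bound (n k m d : nat) :
  k <= n -> 4 <= k -> 0 < m -> 4 * m <= k ->
  144 * k * k * d * fcol n k ('C(k, 2) - k %/ 2 + 1) <= n * n -> expn d m <= n * n.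
Proof.
move=> kn k4 m0 mk; case: (posnP d) => [->|d0]; first by rewrite exp0n.
case: (fcol_attained n k ('C(k, 2) - k %/ 2 + 1)) => [->|[chi good ->]]; last first.
  exact: color_energy_bound.
(* The default value ['C(n, 2)] contradicts the hypothesis, as [n * n <= 4 * 'C(n, 2)]. *)
have n2 : 1 < n by apply: leq_trans kn; apply: leq_trans k4.
have := sqr_le_bin2 n2; have : 0 < 'C(n, 2) by rewrite bin_gt0.
have : 4 < 144 * k * k * d by rewrite -!mulnA (leq_trans (_ : 4 < 144)) // leq_pmulr // !muln_gt0 d0 (leq_trans _ k4).
move: (144 * k * k * d) 'C(n, 2) (n * n) => a b c; nia.
Qed.

Lemma Rpower_INR_natpow (d m : nat) (x : R) :
  (0 < m)%N -> (0 < d)%N -> (0 < x)%R -> (INR (expn d m) <= x)%R ->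
  (INR d <= Rpower x (/ INR m))%R.
Proof.
move=> m0 d0 x0 le_x.
have m_pos : (0 < INR m)%R by apply: lt_0_INR; apply/ltP.
have d_pos : (0 < INR d)%R by apply: lt_0_INR; apply/ltP.
have pow_d : INR (expn d m) = Rpower (INR d) (INR m).
  rewrite Rpower_pow //; elim: m {m0 le_x m_pos} => [|m IH]; first by rewrite expn0.
  by rewrite expnS mult_INR IH.
have -> : INR d = Rpower (Rpower (INR d) (INR m)) (/ INR m).
  by rewrite Rpower_mult Rinv_r ?Rpower_1 //; lra.
apply: Rle_Rpower_l.
  by apply/Rlt_le/Rinv_0_lt_compat.
by rewrite -pow_d; split => //; rewrite pow_d; apply: exp_pos.
Qed.

(* f(n, k, C(k,2) - k/2 + 1) = Omega(n^(2 - 8/k)) for every k >= 8 with 4 | k: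
   there are a constant c > 0 and a threshold N (depending on k) such that
   f(n,k,l) >= c * n^(2-8/k) for all n >= N. *)
Theorem theorem1p2 :
  forall k : nat, (8 <= k)%N -> (4 %| k)%N ->
  exists c : R, (0 < c)%R /\
  exists N : nat, forall n : nat, (N <= n)%N ->
    (c * Rpower (INR n) (2 - 8 / INR k) <= INR (fcol n k ('C(k, 2) - k %/ 2 + 1)))%R.
Proof.
move=> k k8 /dvdnP[m Ek].
have [m2 k4] : (1 < m)%N /\ (4 <= k)%N by lia.
pose B := 144 * k * k.
have B_pos : (0 < INR B)%R by apply: lt_0_INR; apply/ltP; rewrite /B; lia.
(* The factor 2 absorbs [d + 1 <= 2 * y] below. *)
exists (/ (2 * INR B))%R; split; first by apply: Rinv_0_lt_compat; lra.
exists k => n kn.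
set p := fcol n k _.
have n_pos : (0 < INR n)%R by apply: lt_0_INR; apply/ltP; lia.
have n_ge1 : (1 <= INR n)%R by apply: (le_INR 1); apply/leP; lia.
have m_pos : (0 < INR m)%R by apply: lt_0_INR; apply/ltP; lia.
pose y := Rpower (INR n) (8 / INR k).
have y_ge1 : (1 <= y)%R.
  rewrite -(Rpower_O (INR n)) //; apply: Rle_Rpower => //.
  by apply: Rlt_le; apply: Rdiv_lt_0_compat; [lra | apply: lt_0_INR; apply/ltP; lia].
have split_pow : Rpower (INR n) (2 - 8 / INR k) = (INR n * INR n / y)%R.
  rewrite /Rminus Rpower_plus Rpower_Ropp /y.
  by rewrite (_ : 2%R = INR 2) // Rpower_pow //= Rmult_1_r.
have y_root : Rpower (INR n * INR n) (/ INR m) = y.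
  have -> : (INR n * INR n)%R = Rpower (INR n) 2.
    by rewrite (_ : 2%R = INR 2) // Rpower_pow //= Rmult_1_r.
  rewrite Rpower_mult /y Ek mult_INR; congr Rpower.
  by rewrite (_ : INR 4 = 4%R) /=; [field; lra | lra].
(* If [p] were 0, the energy bound would hold for every [d]; [d = n * n + 1] refutes it. *)
have [p0|p_pos] := posnP p.
  have := @fcol_energy_bound n k m (n * n).+1 kn k4 (ltnW m2).
  rewrite -/p p0 muln0 => /(_ _ isT) H.
  have : 4 * m <= k by lia.
  move=> /H; rewrite leqNgt => /negP[].
  rewrite -{1}(expn1 (n * n).+1) -[n * n < _]/((n * n).+1 <= _).
  by rewrite -{1}(expn1 (n * n).+1) leq_exp2l //; nia.
(* The largest [d] to which the energy bound applies. *)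
pose d := (n * n) %/ (B * p).
have d_le : (INR d <= y)%R.
  have [->|d_pos] := posnP d; first by rewrite /=; lra.
  rewrite -y_root; apply: (Rpower_INR_natpow (ltnW m2) d_pos); first by nra.
  rewrite -mult_INR; apply: le_INR; apply/leP.
  apply: (fcol_energy_bound kn k4 (ltnW m2)); first by lia.
  by rewrite -/p -/B -mulnA mulnCA leq_divM.
have upper : (INR n * INR n <= (INR d + 1) * (INR B * INR p))%R.
  rewrite -S_INR -!mult_INR; apply: le_INR; apply/leP; apply: ltnW.
  by apply: ltn_ceil; rewrite muln_gt0 p_pos andbT /B; lia.
have Bp_pos : (0 < INR B * INR p)%R.
  by apply: Rmult_lt_0_compat => //; apply: lt_0_INR; apply/ltP.
rewrite split_pow.
have -> : INR p = (/ (2 * INR B) * ((2 * y) * (INR B * INR p) / y))%R by field; lra.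
apply: Rmult_le_compat_l; first by apply/Rlt_le/Rinv_0_lt_compat; lra.
apply: Rmult_le_compat_r; first by apply/Rlt_le/Rinv_0_lt_compat; lra.
apply: Rle_trans upper _; apply: Rmult_le_compat_r; lra.
Qed.
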